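(* Let $p$ be a prime, $m,s\ge1$, let $\mathcal{C}=(C_1,\dots,C_s)$ generate the digital net $P(\mathcal{C})=\{\boldsymbol{x}_0,\dots,\boldsymbol{x}_{p^m-1}\}$ over $\mathbb{Z}_p$, with associated wavenumber set $\mathcal{K}(\mathcal{C})$. Let $c_0,\dots,c_{p^m-1}\in\mathbb{C}$ and for $\boldsymbol{k}\in\mathcal{K}(\mathcal{C})$ let $\widetilde c(\boldsymbol{k})=p^{-m}\sum_{n=0}^{p^m-1}c_n\overline{\mathrm{wal}_{\boldsymbol{k}}(\boldsymbol{x}_n)}$. For $h_0,\dots,h_{m-1}\in\{0,\dots,p-1\}$ define $D^{(0)}(h_0,\dots,h_{m-1})=\widetilde c(\boldsymbol{k})$, where $\boldsymbol{k}$ is the unique element of $\mathcal{D}(\vec h)\cap\mathcal{K}(\mathcal{C})$, $\vec h=(h_0,\dots,h_{m-1})^T$; and for $r=1,\dots,m$, for all $n_0,\dots,n_{r-1},h_r,\dots,h_{m-1}\in\{0,\dots,p-1\}$, $$D^{(r)}(n_0,\dots,n_{r-1},h_r,\dots,h_{m-1})=\sum_{h_{r-1}=0}^{p-1}\omega_p^{h_{r-1}n_{r-1}}\,D^{(r-1)}(n_0,\dots,n_{r-2},h_{r-1},h_r,\dots,h_{m-1}).$$ Then for $n=n_0+n_1p+\cdots+n_{m-1}p^{m-1}$, $0\le n<p^m$, $$c_n=D^{(m)}(n_0,\dots,n_{m-1}).$$ This recursion computes $c_0,\dots,c_{p^m-1}$ from $(\widetilde c(\boldsymbol{k}))_{\boldsymbol{k}\in\mathcal{K}(\mathcal{C})}$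 in $O(m\,p^{m+1})$ operations, and they can be computed from the same data in $O(m\,p^m\log p)$ operations (with absolute implied constants).
   Context: $p$ is prime, $\mathbb{Z}_p=\{0,\dots,p-1\}$ is the field with $p$ elements, $\mathbb{N}_0$ the non-negative integers, $\omega_p=e^{2\pi i/p}$. Digital net: $C_1,\dots,C_s$ are $m\times m$ matrices over $\mathbb{Z}_p$. For $0\le n<p^m$ with $n=n_0+n_1p+\cdots+n_{m-1}p^{m-1}$ (base $p$ digits) let $\vec n=(n_0,\dots,n_{m-1})^T\in\mathbb{Z}_p^m$, $(y_{j,n,1},\dots,y_{j,n,m})^T=C_j\vec n\in\mathbb{Z}_p^m$, $x_{j,n}=y_{j,n,1}p^{-1}+\cdots+y_{j,n,m}p^{-m}$, and $\boldsymbol{x}_n=(x_{1,n},\dots,x_{s,n})$. $P(\mathcal{C})$ is the family $\boldsymbol{x}_0,\dots,\boldsymbol{x}_{p^m-1}$. Walsh functions: for $k=k_0+k_1p+\cdots+k_{a-1}p^{a-1}\in\mathbb{N}_0$ and $x\in[0,1)$ with base $p$ expansion $x=x_1/p+x_2/p^2+\cdots$ (infinitely many $x_i\ne p-1$), $\mathrm{wal}_k(x)=\omega_p^{x_1k_0+\cdots+x_ak_{a-1}}$; for $\boldsymbol{k}\in\mathbb{N}_0^s$, $\boldsymbol{x}\in[0,1)^s$, $\mathrm{wal}_{\boldsymbol{k}}(\boldsymbol{x})=\prod_{j=1}^s\mathrm{wal}_{k_j}(x_j)$. Dual net cosets: for $\boldsymbol{k}\in\mathbb{N}_0^s$ with $k_j=k_{j,0}+k_{j,1}p+\cdots$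 let $\vec k_j^{(m)}=(k_{j,0},\dots,k_{j,m-1})^T\in\mathbb{Z}_p^m$ and $\mathcal{C}\cdot\boldsymbol{k}=C_1^T\vec k_1^{(m)}+\cdots+C_s^T\vec k_s^{(m)}\in\mathbb{Z}_p^m$. For $\vec h\in\mathbb{Z}_p^m$ let $\mathcal{D}(\vec h)=\{\boldsymbol{k}\in\mathbb{N}_0^s:\mathcal{C}\cdot\boldsymbol{k}=\vec h\}$. Standing assumption: all $p^m$ sets $\mathcal{D}(\vec h)$ are non-empty. The set $\mathcal{K}(\mathcal{C})$: let $\nu(0)=0$, $\nu(k)=1+\max\{i:k_i\ne0\}$ for $k=k_0+k_1p+\cdots>0$, and $\nu(\boldsymbol{k})=\sum_{j=1}^s\nu(k_j)$. $\mathcal{K}(\mathcal{C})$ contains exactly one element of each $\mathcal{D}(\vec h)$, $\vec h\in\mathbb{Z}_p^m$: the element minimizing $\nu$ over $\mathcal{D}(\vec h)$, ties broken by taking the lexicographically smallest. Thus $|\mathcal{K}(\mathcal{C})|=p^m$. ''Operations'' means additions and multiplications of complex numbers, with fixed complex constants (such as powers of roots of unity) available; the correspondence $\boldsymbol{k}\leftrightarrow\vec h=\mathcal{C}\cdot\boldsymbol{k}$ is regarded as known. *)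

(* Defs.v *)
(* MathComp-Analysis; the complex numbers are R[i] for R : realType. *)
From HB Require Import structures.
From mathcomp Require Export all_boot all_order all_algebra.
From mathcomp Require Export all_classical all_reals all_analysis.
From mathcomp.real_closed Require Export complex.

Set Implicit Arguments.
Unset Strict Implicit.
Unset Printing Implicit Defensive.

Export Order.TTheory GRing.Theory Num.Theory.
Export numFieldNormedType.Exports.

Local Open Scope classical_set_scope.
Local Open Scope ring_scope.

Definition omega (R : realType) (p : nat) : R[i] :=
  Complex (cos (2 * pi / p%:R)) (sin (2 * pi / p%:R)).

(* Digits are numbered from 0, so that k = \sum_i digit p k i * p ^ i. *)
Definition digit (p k i : nat) : nat := ((k %/ p ^ i) %% p)%N.

Definition digit_vec (p m k : nat) : 'cV['F_p]_m := \col_(i < m) (digit p k i)%:R.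

(* For k > 0 a nonzero digit has index i with p ^ i <= k, hence i < k (p > 1),
   so the maximum is over all nonzero digits; the empty maximum is 0. *)
Definition nu1 (p k : nat) : nat := (\max_(i < k | digit p k i != 0) i.+1)%N.

Definition nu (p s : nat) (k : s.-tuple nat) : nat :=
  (\sum_(j < s) nu1 p (tnth k j))%N.

(* d i is the (i+1)-st digit after the radix point. *)
Definition is_expansion (R : realType) (p : nat) (x : R) (d : nat -> nat) : Prop :=
  [/\ forall i, (d i < p)%N,
      (fun N : nat => \sum_(0 <= i < N) (d i)%:R / p%:R ^+ i.+1 : R) @ \oo --> x
    & forall N : nat, exists2 i : nat, (N <= i)%N & d i != p.-1].

Definition expansion (R : realType) (p : nat) (x : R) : nat -> nat :=
  xget (fun=> 0%N) [set d | is_expansion p x d].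

(* The digits of k vanish from position [nu1 p k] on. *)
Definition wal1 (R : realType) (p k : nat) (x : R) : R[i] :=
  omega R p ^+ (\sum_(i < nu1 p k) expansion p x i * digit p k i)%N.

Definition wal (R : realType) (p s : nat) (k : s.-tuple nat) (x : 'I_s -> R) : R[i] :=
  \prod_(j < s) wal1 p (tnth k j) (x j).

(* In the sum the coercion from 'F_p to nat picks the representative in
   {0, ..., p-1}. *)
Definition net_point (R : realType) (p m s : nat) (C : 'I_s -> 'M['F_p]_m)
    (n : nat) (j : 'I_s) : R :=
  \sum_(i < m) ((C j *m digit_vec p m n) i 0 : nat)%:R / p%:R ^+ i.+1.

Definition dual_map (p m s : nat) (C : 'I_s -> 'M['F_p]_m) (k : s.-tuple nat) :
    'cV['F_p]_m :=
  \sum_(j < s) (C j)^T *m digit_vec p m (tnth k j).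

Definition dual_coset (p m s : nat) (C : 'I_s -> 'M['F_p]_m) (h : 'cV['F_p]_m) :
    set (s.-tuple nat) :=
  [set k | dual_map C k = h].

Definition lex_le (s : nat) (k l : s.-tuple nat) : bool :=
  ((k : s.-tuplelexi nat) <= (l : s.-tuplelexi nat))%O.

Definition wavenumbers (p m s : nat) (C : 'I_s -> 'M['F_p]_m) : set (s.-tuple nat) :=
  [set k | forall l, dual_coset C (dual_map C k) l ->
     (nu p k < nu p l)%N \/ (nu p k = nu p l /\ lex_le k l)].

(* When [dual_coset C h] is non-empty it meets [wavenumbers C] in exactly one point, so the default
   value of xget is never used. *)
Definition wavenumber (p m s : nat) (C : 'I_s -> 'M['F_p]_m) (h : 'cV['F_p]_m) :
    s.-tuple nat :=
  xget [tuple of nseq s 0%N] (dual_coset C h `&` wavenumbers C).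

Definition walsh_coef (R : realType) (p m s : nat) (C : 'I_s -> 'M['F_p]_m)
    (c : 'I_(p ^ m) -> R[i]) (k : s.-tuple nat) : R[i] :=
  p%:R ^- m * \sum_(n < p ^ m) c n * (wal p k (net_point R C n))^*.

Definition set_coord (F : Type) (m : nat) (a : 'cV[F]_m) (i : 'I_m) (h : F) : 'cV[F]_m :=
  \col_j (if j == i then h else a j 0).

(* D r (a_0, ..., a_{m-1}) stands for
   D^(r)(n_0, ..., n_{r-1}, h_r, ..., h_{m-1}): the first r coordinates are the
   n_i, the others the h_i. The index r : 'I_m is r - 1 in D^(r). *)
Definition is_recursion (R : realType) (p m s : nat) (C : 'I_s -> 'M['F_p]_m)
    (c : 'I_(p ^ m) -> R[i]) (D : nat -> 'cV['F_p]_m -> R[i]) : Prop :=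
  (forall h, D 0%N h = walsh_coef C c (wavenumber C h)) /\
  (forall (r : 'I_m) (a : 'cV['F_p]_m),
     D r.+1 a = \sum_(h : 'F_p) omega R p ^+ (h * a r 0%R)%N * D r (set_coord a r h)).

(* Inputs are named by I and are read only, scratch registers are named by W;
   every instruction is one addition or one multiplication in F, whose operands
   may be arbitrary constants, so the length of a program is its number of
   operations. *)
Inductive operand (F I W : Type) : Type :=
  | Inp of I
  | Reg of W
  | Cst of F.

Inductive instr (F I W : Type) : Type :=
  | Add of W & operand F I W & operand F I W
  | Mul of W & operand F I W & operand F I W.

Arguments Inp {F I W}.
Arguments Reg {F I W}.
Arguments Cst {F I W}.
Arguments Add {F I W}.
Arguments Mul {F I W}.

Section Run.
Variables (F : nzRingType) (I : Type) (W : eqType).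

Definition value (x : I -> F) (mem : W -> F) (o : operand F I W) : F :=
  match o with
  | Inp i => x i
  | Reg w => mem w
  | Cst z => z
  end.

Definition store (mem : W -> F) (w : W) (z : F) : W -> F :=
  fun w' => if w' == w then z else mem w'.

Definition step (x : I -> F) (mem : W -> F) (q : instr F I W) : W -> F :=
  match q with
  | Add w o1 o2 => store mem w (value x mem o1 + value x mem o2)
  | Mul w o1 o2 => store mem w (value x mem o1 * value x mem o2)
  end.

(* Scratch registers initially hold 0. *)
Definition run (P : seq (instr F I W)) (x : I -> F) : W -> F :=
  foldl (step x) (fun=> 0) P.

Definition result (P : seq (instr F I W)) (x : I -> F) (o : operand F I W) : F :=
  value x (run P x) o.

End Run.

(* The recursion as a straight-line program: the value D^(r)(a) with r > 0 is
   accumulated in register Some (r, a), D^(0)(h) is the input h, and None holds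
   the current product. *)
Definition rec_loc (R : realType) (p m r : nat) (a : 'cV['F_p]_m) :
    operand R[i] 'cV['F_p]_m (option (nat * 'cV['F_p]_m)) :=
  if r is 0%N then Inp a else Reg (Some (r, a)).

Definition rec_stage (R : realType) (p m : nat) (r : 'I_m) :
    seq (instr R[i] 'cV['F_p]_m (option (nat * 'cV['F_p]_m))) :=
  flatten [seq
    flatten [seq
      [:: Mul None (Cst (omega R p ^+ (h * a r 0%R)%N)) (rec_loc R r (set_coord a r h));
          Add (Some (r.+1, a)) (Reg (Some (r.+1, a))) (Reg None)]
    | h : 'F_p <- enum 'F_p]
  | a : 'cV['F_p]_m <- enum 'cV['F_p]_m].

Definition rec_program (R : realType) (p m : nat) :
    seq (instr R[i] 'cV['F_p]_m (option (nat * 'cV['F_p]_m))) :=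
  flatten [seq rec_stage R p r | r <- enum 'I_m].

(* Main.v *)
Require Import Defs.
From mathcomp Require Import ring lra zify.

Set Implicit Arguments.
Unset Strict Implicit.
Unset Printing Implicit Defensive.

Local Open Scope classical_set_scope.
Local Open Scope ring_scope.

(** The idea is that the net turns the Walsh transform into the Fourier transform
    of the group F_p^m. Since the base p digits of the points are linear in the
    digit vector of n, moving the matrices to the other side of the inner product
    gives wal_k(x_n) = omega^(h . n) with h = C . k ([wal_net_point]); this needs
    that the digits chosen in the definition of the net points are the ones seen
    by the Walsh functions ([expansion_finite]). As the chosen wavenumbers run
    through all h ([dual_map_wavenumber]), the numbers c~(k) are the Fourier
    coefficients of c on F_p^m, and orthogonality of characters ([sum_chi])
    inverts them ([transform_walsh_coef]). The recursion evaluates the inverse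
    transform one coordinate at a time: D^(r) is the transform in the first r
    coordinates ([partial_transformS], [recursionE]).

    Each of the m stages consists of p^(m-1) discrete Fourier transforms of
    length p. Done naively they cost 2 p^2 operations each, which is the first
    bound ([size_rec_program]); for the second it suffices to compute a transform
    of length p in O(p log p) operations although p is prime. This is Bluestein's
    method: h i = C(h + i, 2) - C(h, 2) - C(i, 2) turns the transform into a
    Hankel matrix between two diagonal ones ([derives_dft]), a Hankel matrix is
    part of a cyclic correlation whose length is a power of two
    ([derives_hankel]), and the radix-2 fast Fourier transform diagonalises that
    correlation ([derives_fft]).

    Costs are counted in a module: [derives S n T] says that the vectors in T
    arise from those in S by at most n additions and scalings. Composition
    of such derivations is transitivity, with no registers to rename; they become
    programs only at the end ([derives_program]). *)

(** * Linear straight-line computations in a module *)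

(** A computed vector joins the set of available ones, so the recursion is on
    the first operation. *)
Inductive derives (F : nzRingType) (V : lmodType F) :
    set V -> nat -> set V -> Prop :=
  | derives_sub S n T : T `<=` S -> derives S n T
  | derives_add S n T u v : S u -> S v ->
      derives (S `|` [set u + v]) n T -> derives S n.+1 T
  | derives_scale S n T z u : S u ->
      derives (S `|` [set z *: u]) n T -> derives S n.+1 T.

Section Derivations.
Variables (F : nzRingType) (V : lmodType F).
Implicit Types (S T U : set V) (u v : V) (n : nat).

Lemma derivesS S S' n n' T T' :
  S `<=` S' -> (n <= n')%N -> T' `<=` T -> derives S n T -> derives S' n' T'.
Proof.
move=> SS' nn' TT' d; elim: d S' n' T' SS' nn' TT' => {S n T}.
- by move=> S n T TS S' n' T' SS' _ T'T; apply: derives_sub => v /T'T/TS/SS'.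
- move=> S n T u v Su Sv _ IH S' [//|n'] T' SS' nn' T'T.
  by apply: (derives_add (SS' _ Su) (SS' _ Sv)); apply: IH => //; apply: setSU.
- move=> S n T z u Su _ IH S' [//|n'] T' SS' nn' T'T.
  by apply: (derives_scale (z := z) (SS' _ Su)); apply: IH => //; apply: setSU.
Qed.

Lemma derives_trans S n T m U :
  derives S n T -> derives (S `|` T) m U -> derives S (n + m) U.
Proof.
move=> d; elim: d m U => {S n T}.
- move=> S n T TS m U; apply: derivesS => //; last exact: leq_addl.
  by rewrite setUidl.
- move=> S n T u v Su Sv _ IH m U d; apply: (derives_add Su Sv); apply: IH.
  by apply: derivesS d => //; apply: setSU; apply: subsetUl.
- move=> S n T z u Su _ IH m U d; apply: (derives_scale (z := z) Su); apply: IH.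
  by apply: derivesS d => //; apply: setSU; apply: subsetUl.
Qed.

Lemma derives_setU S n T m U :
  derives S n T -> derives S m U -> derives S (n + m) (T `|` U).
Proof.
move=> dT dU; apply: (derives_trans dT).
rewrite -[m]addn0; apply: (@derives_trans _ _ U).
  by apply: derivesS dU => //; apply: subsetUl.
by apply: derives_sub => v [] ?; [left; right|right].
Qed.

Lemma derives_bigcup (J : eqType) S n (s : seq J) (T : J -> set V) :
  (forall j, j \in s -> derives S n (T j)) ->
  derives S (size s * n) (\bigcup_(j in [set` s]) T j).
Proof.
elim: s => [|j s IH] dT; first by apply: derives_sub => v [].
have dj := dT j (mem_head j s).
have ds : derives S (size s * n) (\bigcup_(i in [set` s]) T i).
  by apply: IH => i si; apply: dT; rewrite inE si orbT.
apply: derivesS (derives_setU dj ds) => // v [i /=].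
by rewrite inE => /predU1P[->|si] Tv; [left|right; exists i].
Qed.

Lemma derives_scale1 S z u : S u -> derives S 1 [set z *: u].
Proof.
by move=> Su; apply: (derives_scale (z := z) Su); apply: derives_sub; apply: subsetUr.
Qed.

Lemma derives_add_scale S z u v : S u -> S v -> derives S 2 [set u + z *: v].
Proof.
move=> Su Sv; apply: (derives_scale (z := z) Sv).
apply: (@derives_add _ _ _ _ _ u (z *: v)); [by left|by right|].
by apply: derives_sub; apply: subsetUr.
Qed.

(** The radix-2 step: with E and O the transforms of the even and the odd
    subsequence at the root [z ^+ 2], the transform at n is [E n + z ^+ n *: O n];
    it is 2 ^ k-periodic in n, so only 2 ^ k values have to be formed. *)
Lemma derives_fft k (z : F) (u : nat -> V) S :
  z ^+ (2 ^ k) = 1 -> (forall h, (h < 2 ^ k)%N -> S (u h)) ->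
  derives S (2 * k * 2 ^ k)
    (range (fun n : nat => \sum_(h < 2 ^ k) z ^+ (h * n)%N *: u h)).
Proof.
elim: k z u S => [|k IH] z u S zk Su.
  apply: derives_sub => _ [n _ <-].
  by rewrite big_ord1 mul0n expr0 scale1r; apply: Su.
pose E n := \sum_(h < 2 ^ k) (z ^+ 2) ^+ (h * n)%N *: u h.*2.
pose O n := \sum_(h < 2 ^ k) (z ^+ 2) ^+ (h * n)%N *: u h.*2.+1.
have z2k : (z ^+ 2) ^+ (2 ^ k) = 1 by rewrite -exprM -expnS.
have dE : derives S (2 * k * 2 ^ k) (range E).
  by apply: (IH _ (fun h => u h.*2)) => // h hk; apply: Su; rewrite expnS; lia.
have dO : derives S (2 * k * 2 ^ k) (range O).
  by apply: (IH _ (fun h => u h.*2.+1)) => // h hk; apply: Su; rewrite expnS; lia.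
pose X n := \sum_(h < 2 ^ k.+1) z ^+ (h * n)%N *: u h.
have XE n : X n = E n + z ^+ n *: O n.
  rewrite /X /E /O scaler_sumr -big_split /=.
  rewrite -(big_mkord xpredT (fun h => z ^+ (h * n)%N *: u h)).
  rewrite -(big_mkord xpredT (fun h =>
    (z ^+ 2) ^+ (h * n)%N *: u h.*2 + z ^+ n *: ((z ^+ 2) ^+ (h * n)%N *: u h.*2.+1))).
  rewrite expnS mul2n; elim: (2 ^ k)%N => [|N IHN]; first by rewrite !big_nil.
  rewrite doubleS !big_nat_recr //= IHN addrA; congr (_ + _ *: _ + _).
    by rewrite -exprM mulnA mul2n.
  by rewrite scalerA -exprM -exprD mulnA mul2n mulSn.
have Xper n : X n = X (n %% 2 ^ k.+1)%N.
  apply: eq_bigr => h _; congr (_ *: _).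
  by rewrite {1}(divn_eq n (2 ^ k.+1)) mulnDr exprD mulnA mulnC exprM zk expr1n mul1r.
have dX : derives (S `|` (range E `|` range O)) (2 ^ k.+1 * 2) (range X).
  rewrite -[X in (X * 2)%N](size_iota 0).
  apply: (@derivesS _ _ _ _ (\bigcup_(n in [set` iota 0 (2 ^ k.+1)]) [set X n])
    _ (@subset_refl _ _) (leqnn _)).
    move=> _ [n _ <-]; exists (n %% 2 ^ k.+1)%N; last by rewrite /= -Xper.
    by rewrite /= mem_iota add0n ltn_mod expn_gt0.
  by apply: derives_bigcup => n _; rewrite XE; apply: derives_add_scale;
    [right; left; exists n | right; right; exists n].
apply: derivesS (derives_trans (derives_setU dE dO) dX) => //.
by rewrite expnS; lia.
Qed.

End Derivations.

Lemma sum_unity_root (F : idomainType) N (x : F) :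
  x ^+ N = 1 -> \sum_(l < N) x ^+ l = if x == 1 then N%:R else 0.
Proof.
move=> xN; case: eqP => [->|/eqP x1].
  by under eq_bigr do rewrite expr1n; rewrite sumr_const card_ord.
apply/eqP; have /eqP := subrX1 x N; rewrite xN subrr eq_sym mulf_eq0 subr_eq0.
by rewrite (negPf x1).
Qed.

Lemma bin2D h n : 'C(h + n, 2) = ('C(h, 2) + 'C(n, 2) + h * n)%N.
Proof.
elim: n => [|n IH]; first by rewrite addn0 muln0 !addn0.
by rewrite addnS !binS !bin1 IH mulnS; lia.
Qed.

(** A Hankel matrix of size n is a corner of the cyclic correlation of any
    length [2 ^ k >= 2 * n], which the transform of that length diagonalises:
    the transform of the sequence w is a list of constants, so only the
    transform of u and one further transform have to be computed. *)
Lemma derives_hankel (F : fieldType) (V : lmodType F) (S : set V) n k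
    (zeta : F) (w : nat -> F) (u : nat -> V) :
  (2 ^ k)%N.-primitive_root zeta -> (2 * n <= 2 ^ k)%N -> S 0 ->
  (forall h, (h < n)%N -> S (u h)) ->
  derives S ((4 * k + 1) * 2 ^ k)
    [set v | exists2 i, (i < n)%N & v = \sum_(h < n) w (h + i)%N *: u h].
Proof.
move=> prim nk S0 Su; set N := (2 ^ k)%N in prim nk *.
have zN := prim_expr_order prim.
have N0 := prim_root_natf_neq0 prim.
have z0 : zeta != 0 by rewrite (prim_root_eq0 prim) expn_eq0.
pose u0 h := if (h < n)%N then u h else 0.
pose U l := \sum_(h < N) zeta ^+ (h * l)%N *: u0 h.
pose W l := \sum_(j < N) w j * (zeta ^+ j)^-1 ^+ l.
pose Y l := (N%:R^-1 * W l) *: U l.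
have dU : derives S (2 * k * N) (range U).
  by apply: derives_fft => // h _; rewrite /u0; case: ifP => // /Su.
have dY : derives (S `|` range U) (N * 1) (\bigcup_(l in [set` iota 0 N]) [set Y l]).
  rewrite -[X in (X * _)%N](size_iota 0); apply: derives_bigcup => l _.
  by apply: derives_scale1; right; exists l.
have dZ : derives (S `|` \bigcup_(l in [set` iota 0 N]) [set Y l]) (2 * k * N)
    (range (fun i => \sum_(l < N) zeta ^+ (l * i)%N *: Y l)).
  by apply: derives_fft => // l lN; right; exists l => //=; rewrite mem_iota.
have dYZ := derives_trans dU (derives_trans dY
  (derivesS (setSU (@subsetUl _ S (range U))) (leqnn _) (@subset_refl _ _) dZ)).
apply: derivesS dYZ => //; first by rewrite /N; lia.
move=> _ [i ilt ->]; exists i => //; rewrite /Y /U.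
under eq_bigr do rewrite scaler_sumr scaler_sumr.
(* Summing over l first, the coefficient of [u h] is
   [N^-1 * \sum_j w j * \sum_l (zeta ^+ (h + i - j)) ^+ l], in which only
   j = h + i < N survives. *)
rewrite exchange_big /=.
have nN : (n <= N)%N by lia.
rewrite (big_ord_widen N (fun h => w (h + i)%N *: u h) nN) [RHS]big_mkcond /=.
apply: eq_bigr => h _; under eq_bigr do rewrite !scalerA.
rewrite -scaler_suml /u0; case: ifPn => hn; last by rewrite scaler0.
congr (_ *: _).
pose j0 := Ordinal (ltac:(lia) : (h + i < N)%N).
transitivity (\sum_(j < N) N%:R^-1 * w j *
    \sum_(l < N) (zeta ^+ (h + i) / zeta ^+ j) ^+ l).
  transitivity (\sum_(l < N) \sum_(j < N)
      N%:R^-1 * w j * (zeta ^+ (h + i) / zeta ^+ j) ^+ l).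
    apply: eq_bigr => l _; rewrite /W mulr_sumr mulr_sumr mulr_suml.
    apply: eq_bigr => j _; rewrite exprMn -exprM mulnDl exprD.
    by rewrite [(l * i)%N]mulnC; ring.
  by rewrite exchange_big; apply: eq_bigr => j _; rewrite mulr_sumr.
rewrite (bigD1 j0) //= [X in _ + X]big1 ?addr0 => [|j jj0].
  rewrite divff ?expf_neq0 //; under eq_bigr do rewrite expr1n.
  by rewrite sumr_const card_ord mulrAC mulVf // mul1r.
rewrite sum_unity_root; last first.
  by rewrite expr_div_n -!exprM ![(_ * N)%N]mulnC !exprM zN !expr1n divr1.
rewrite ifN ?mulr0 //; apply: contraNneq jj0 => /(divr1_eq) /eqP.
rewrite (eq_prim_root_expr prim) !modn_small ?ltn_ord //; last by lia.
by move=> /eqP hij; apply/eqP/val_inj.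
Qed.

(** The identity [h * i = 'C(h + i, 2) - 'C(h, 2) - 'C(i, 2)] turns the transform
    of length n into a Hankel matrix between two diagonal ones. The exponent k
    makes [2 ^ k] the least power of two with [2 * n <= 2 ^ k]. *)
Lemma derives_dft (F : fieldType) (V : lmodType F) (S : set V) n (omega zeta : F)
    (u : nat -> V) (k := up_log 2 (2 * n)) :
  (0 < n)%N -> omega != 0 -> (2 ^ k)%N.-primitive_root zeta -> S 0 ->
  (forall h, (h < n)%N -> S (u h)) ->
  derives S (24 * k * n)
    [set v | exists2 i, (i < n)%N & v = \sum_(h < n) omega ^+ (h * i)%N *: u h].
Proof.
move=> n0 om0 prim S0 Su.
have [k0 /andP[kn nk]] : (0 < k)%N /\ (2 ^ k.-1 < 2 * n <= 2 ^ k)%N.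
  by split; [rewrite up_log_gt0; lia | apply: up_log_bounds; lia].
have {}kn : (2 ^ k < 4 * n)%N by case: (k) k0 kn => // k' _; rewrite expnS /=; lia.
pose d h := (omega ^+ 'C(h, 2))^-1.
pose v h := d h *: u h.
have dv : derives S (n * 1) (\bigcup_(h in [set` iota 0 n]) [set v h]).
  rewrite -[X in (X * _)%N](size_iota 0 n); apply: derives_bigcup => h.
  by rewrite mem_iota => hn; apply: derives_scale1; apply: Su.
pose y i := \sum_(h < n) omega ^+ 'C(h + i, 2) *: v h.
have dy : derives (S `|` \bigcup_(h in [set` iota 0 n]) [set v h])
    ((4 * k + 1) * 2 ^ k) [set x | exists2 i, (i < n)%N & x = y i].
  apply: (derives_hankel (fun l => omega ^+ 'C(l, 2)) prim nk); first by left.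
  by move=> h hn; right; exists h => //=; rewrite mem_iota.
have dx : derives (S `|` [set x | exists2 i, (i < n)%N & x = y i]) (n * 1)
    (\bigcup_(i in [set` iota 0 n]) [set d i *: y i]).
  rewrite -[X in (X * _)%N](size_iota 0 n); apply: derives_bigcup => i.
  by rewrite mem_iota => hi; apply: derives_scale1; right; exists i.
have dall := derives_trans dv (derives_trans dy
  (derivesS (setSU (@subsetUl _ S _)) (leqnn _) (@subset_refl _ _) dx)).
apply: derivesS dall => //.
  have : ((4 * k + 2) * 2 ^ k <= 6 * k * (4 * n))%N by apply: leq_mul; lia.
  by lia.
move=> _ [i ilt ->]; exists i; first by rewrite /= mem_iota.
rewrite /= /y scaler_sumr; apply: eq_bigr => h _; rewrite /v !scalerA.
congr (_ *: _); rewrite bin2D !exprD /d.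
have := expf_neq0 'C(h, 2) om0; have := expf_neq0 'C(i, 2) om0.
by move=> ? ?; field; apply/andP.
Qed.

(** * From derivations to programs *)

Section Programs.
Variables (F : nzRingType) (I : Type).

(** Linear forms in the inputs live in the module of all functions of the
    inputs, on which [derives] and [result] can be compared. *)
Local Notation forms := ((I -> F) -> F^o).

Definition bounded_operand (k : nat) (o : operand F I nat) : bool :=
  if o is Reg w then (w < k)%N else true.

Definition readable (P : seq (instr F I nat)) (k : nat) : set forms :=
  [set g | exists2 o, bounded_operand k o & forall x, result P x o = g x].

Lemma readable_rcons P k q o1 o2 :
  q = Add k o1 o2 \/ q = Mul k o1 o2 ->
  readable P k `<=` readable (rcons P q) k.+1.
Proof.
move=> qE g [op ok oE]; exists op; first by case: op ok {oE} => //= w' /ltnW.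
move=> x; rewrite -oE /result /run foldl_rcons.
by case: op ok {oE} => //= w'; case: qE => -> /=; rewrite /store; case: ltngtP.
Qed.

Lemma derives_readable S n T P k :
  derives S n T -> S `<=` readable P k ->
  exists P' k', (size P' <= size P + n)%N /\ T `<=` readable P' k'.
Proof.
move=> d; elim: d P k => {S n T}.
- move=> S n T TS P k SP; exists P, k; split; first exact: leq_addr.
  exact: subset_trans SP.
- move=> S n T u v Su Sv _ IH P k SP.
  have [op1 _ uE] := SP _ Su; have [op2 _ vE] := SP _ Sv.
  pose q := Add k op1 op2.
  have [|P' [k' [sP' TP']]] := IH (rcons P q) k.+1.
    rewrite subUset; split.
      by apply: subset_trans SP _; apply: (@readable_rcons _ _ _ op1 op2); left.
    move=> _ ->; exists (Reg k) => //= x.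
    rewrite -[RHS]/(u x + v x) -uE -vE.
    by rewrite /result /run foldl_rcons /= /store eqxx.
  by exists P', k'; rewrite size_rcons addSnnS in sP'.
- move=> S n T z u Su _ IH P k SP.
  have [op _ uE] := SP _ Su; pose q := Mul k (Cst z) op.
  have [|P' [k' [sP' TP']]] := IH (rcons P q) k.+1.
    rewrite subUset; split.
      by apply: subset_trans SP _; apply: (@readable_rcons _ _ _ (Cst z) op); right.
    move=> _ ->; exists (Reg k) => //= x.
    rewrite -[RHS]/(z * u x) -uE.
    by rewrite /result /run foldl_rcons /= /store eqxx.
  by exists P', k'; rewrite size_rcons addSnnS in sP'.
Qed.

Lemma derives_program n (T : set forms) :
  derives (range (fun i => (fun x => x i) : forms) `|` [set 0]) n T ->
  exists2 P : seq (instr F I nat), (size P <= n)%N &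
    forall g, T g -> exists o, forall x, result P x o = g x.
Proof.
move=> /(@derives_readable _ _ _ [::] 0%N)[|P [k [sP TP]]].
  rewrite subUset; split=> [_ [i _ <-]|_ ->]; first by exists (Inp i).
  by exists (Cst 0).
by exists P => // g /TP[op _ oE]; exists op.
Qed.

End Programs.

(** * The multidimensional transform *)

Lemma sum_Fp (V : nmodType) p (f : nat -> V) :
  prime p -> \sum_(h : 'F_p) f h = \sum_(h < p) f h.
Proof. by move=> pp; rewrite -[in RHS](Fp_cast pp). Qed.

(** Varying coordinate r maps each element of the set to p vectors, and these
    are all distinct. *)
Lemma card_coord0 p m (r : 'I_m) :
  prime p -> (#|[pred b : 'cV['F_p]_m | b r 0%R == 0%R]| * p <= p ^ m)%N.
Proof.
move=> pp; set B := [pred b : 'cV['F_p]_m | b r 0 == 0].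
pose f (bh : 'cV['F_p]_m * 'F_p) := set_coord bh.1 r bh.2.
have inj : {in [predX B & predT] &, injective f}.
  move=> [b h] [b1 h1] /andP[/eqP b0 _] /andP[/eqP b10 _] /colP E.
  have -> : h = h1 by have := E r; rewrite !mxE eqxx.
  congr (_, _); apply/colP => j; have := E j; rewrite !mxE.
  by case: eqP => [->|//]; rewrite b0 b10.
have := max_card (mem [seq f bh | bh in [predX B & predT]]).
by rewrite (card_in_image inj) cardX card_mx !card_Fp // muln1.
Qed.

Section PartialTransform.
Variables (F : fieldType) (V : lmodType F) (p m : nat) (om : F).
Variable x : 'cV['F_p]_m -> V.
Implicit Types (a : 'cV['F_p]_m) (r : nat).

(** The transform of x in the coordinates of index less than r; the other
    coordinates of a are kept. *)
Definition partial_transform r a : V :=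
  \sum_(h : 'cV['F_p]_m | [forall i : 'I_m, (r <= i)%N ==> (h i 0 == a i 0)])
    om ^+ (\sum_(i < m | (i < r)%N) h i 0%R * a i 0%R)%N *: x h.

Lemma partial_transform0 a : partial_transform 0 a = x a.
Proof.
rewrite /partial_transform (big_pred1 a) => [|h] /=.
  by rewrite big_pred0 ?expr0 ?scale1r.
apply/forallP/eqP => [ha|-> //]; by apply/colP => i; apply/eqP/ha.
Qed.

Lemma partial_transform_full a :
  partial_transform m a =
  \sum_(h : 'cV['F_p]_m) om ^+ (\sum_i h i 0%R * a i 0%R)%N *: x h.
Proof.
apply: eq_big => [h|h _]; first by apply/forallP => i; rewrite leqNgt ltn_ord.
by congr (om ^+ _ *: _); apply: eq_bigl => i; rewrite ltn_ord.
Qed.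

(** Group the terms according to the rth coordinate of the summation vector. *)
Lemma partial_transformS (r : 'I_m) a :
  partial_transform r.+1 a =
  \sum_(h : 'F_p) om ^+ (h * a r 0%R)%N *: partial_transform r (set_coord a r h).
Proof.
rewrite {1}/partial_transform (partition_big (fun h : 'cV['F_p]_m => h r 0) xpredT) //=.
apply: eq_bigr => t _; rewrite scaler_sumr; apply: eq_big => [h|h].
  apply/andP/forallP => [[/forallP ha /eqP hr] i|ha].
    apply/implyP => ri; rewrite mxE; have [->|ir] := eqVneq i r; first by rewrite hr.
    have /implyP := ha i; apply; rewrite ltn_neqAle ri andbT.
    by apply: contraNneq ir => /val_inj ->.
  split; last by have := ha r; rewrite leqnn mxE eqxx.
  apply/forallP => i; apply/implyP => ri; have := ha i; rewrite (ltnW ri) mxE ifN //.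
  by apply: contraTneq ri => ->; rewrite ltnn.
move=> /andP[_ /eqP hr]; rewrite scalerA -exprD; congr (om ^+ _ *: _).
rewrite (bigD1 r) //= hr; congr (_ + _)%N; apply: eq_big => [i|i /andP[_ ir]].
  by rewrite ltnS ltn_neqAle andbC.
by rewrite mxE (negPf ir).
Qed.

(** A stage splits into transforms of length p, one on each line in the
    direction of coordinate r; a line is named by its point b with [b r 0 = 0]. *)
Lemma derives_stage (zeta : F) (S : set V) (r : 'I_m) (k := up_log 2 (2 * p)) :
  prime p -> om != 0 -> (2 ^ k)%N.-primitive_root zeta -> S 0 ->
  range (partial_transform r) `<=` S ->
  derives S (24 * k * p ^ m) (range (partial_transform r.+1)).
Proof.
move=> pp om0 prim S0 Sr; pose B := [pred b : 'cV['F_p]_m | b r 0 == 0].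
pose u b (h : nat) := partial_transform r (set_coord b r h%:R).
have dB b : b \in enum B -> derives S (24 * k * p)
    [set v | exists2 i, (i < p)%N & v = \sum_(h < p) om ^+ (h * i)%N *: u b h].
  move=> _; apply: derives_dft prim S0 _ => //; first exact: prime_gt0.
  by move=> h _; apply: Sr; exists (set_coord b r h%:R).
apply: derivesS (derives_bigcup dB) => //.
  by rewrite -cardE mulnCA leq_mul2l card_coord0 ?orbT.
move=> _ [a _ <-]; exists (set_coord a r 0).
  by rewrite /= mem_enum inE mxE eqxx.
exists (a r 0); first by have := ltn_ord (a r 0); rewrite [X in (_ < X)%N]Fp_cast.
rewrite partial_transformS.
rewrite -(sum_Fp (fun h => om ^+ (h * a r 0%R)%N *: u (set_coord a r 0) h) pp).
apply: eq_bigr => h _; congr (_ *: partial_transform _ _).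
by apply/colP => j; rewrite !mxE natr_Zp; case: (j == r).
Qed.

Lemma derives_transform (zeta : F) (k := up_log 2 (2 * p)) :
  prime p -> om != 0 -> (2 ^ k)%N.-primitive_root zeta ->
  derives (range x `|` [set 0]) (m * (24 * k * p ^ m)) (range (partial_transform m)).
Proof.
move=> pp om0 prim; set S := _ `|` _.
suff H r : (r <= m)%N -> derives S (r * (24 * k * p ^ m)) (range (partial_transform r)).
  exact: H.
elim: r => [_|r IH rm].
  by apply: derives_sub => _ [a _ <-]; left; exists a => //; rewrite partial_transform0.
rewrite mulSn addnC; apply: derives_trans (IH (ltnW rm)) _.
by apply: (@derives_stage zeta _ (Ordinal rm)) => //; left; right.
Qed.

End PartialTransform.

(** * Additive characters of F_p *)

Lemma omegaX (R : realType) N j (t := 2 * pi / N%:R : R) :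
  omega R N ^+ j = Complex (cos (t *+ j)) (sin (t *+ j)).
Proof.
elim: j => [|j IH]; first by rewrite !mulr0n cos0 sin0.
rewrite exprS IH mulrS cosD sinD; apply/eqP; rewrite eq_complex /= -/t.
by rewrite [X in _ && (X == _)]addrC !eqxx.
Qed.

(** The order d of [omega R N] divides N; if d < N then 0 < pi * d / N < pi, so
    that the sine of this angle is nonzero and the cosine of its double is not 1. *)
Lemma omega_prim (R : realType) N : (0 < N)%N -> N.-primitive_root (omega R N).
Proof.
move=> N0; have NR : (N%:R : R) != 0 by rewrite pnatr_eq0 -lt0n.
have omN : omega R N ^+ N = 1.
  have tN : 2 * pi / N%:R *+ N = pi *+ 2 :> R.
    by rewrite -[LHS]mulr_natr divfK // mulrC mulr_natr.
  by rewrite omegaX tN cos2pi mulr2n sinD sinpi cospi !(mul0r, mulr0) addr0.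
have [d prim dN] := prim_order_exists N0 omN.
have d0 := prim_order_gt0 prim.
have := dvdn_leq N0 dN; rewrite leq_eqVlt => /predU1P[dE|dltN].
  by rewrite -[X in X.-primitive_root _]dE.
have := prim_expr_order prim; rewrite omegaX => -[+ _].
set t : R := pi * d%:R / N%:R.
have -> : 2 * pi / N%:R *+ d = t *+ 2 :> R.
  by rewrite -[LHS]mulr_natr -[RHS]mulr_natr /t; field.
rewrite cos_mulr2n => cos1.
have sin_t : 0 < sin t.
  apply: sin_gt0_pi; rewrite /t; apply/andP; split.
    by rewrite divr_gt0 ?mulr_gt0 ?pi_gt0 ?ltr0n.
  by rewrite ltr_pdivrMr ?ltr0n // ltr_pM2l ?pi_gt0 // ltr_nat.
have := cos2Dsin2 t; have := exprn_gt0 2 sin_t; move: cos1; lra.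
Qed.

Lemma omega_neq0 (R : realType) N : omega R N != 0.
Proof.
apply/eqP => -[c0 s0]; have := cos2Dsin2 (2 * pi / N%:R : R).
by rewrite c0 s0 expr0n addr0 => /esym/eqP; rewrite oner_eq0.
Qed.

Lemma conj_omega (R : realType) N : (omega R N)^* = (omega R N)^-1.
Proof.
apply: (mulfI (omega_neq0 R N)); rewrite divff ?omega_neq0 //.
apply/eqP; rewrite eq_complex /=; apply/andP; split; apply/eqP.
  by rewrite -[RHS](cos2Dsin2 (2 * pi / N%:R)); ring.
by ring.
Qed.

Lemma omega_congr (R : realType) p a b : prime p ->
  a%:R = b%:R :> 'F_p -> omega R p ^+ a = omega R p ^+ b.
Proof.
move=> pp ab; have prim := omega_prim R (prime_gt0 pp).
rewrite -(prim_expr_mod prim) -[RHS](prim_expr_mod prim).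
by rewrite -!(val_Fp_nat pp) ab.
Qed.

Definition chi (R : realType) p (a : 'F_p) : R[i] := omega R p ^+ a.

Section Character.
Variables (R : realType) (p : nat).
Hypothesis pp : prime p.
Local Notation chi := (chi R (p := p)).

Lemma chi_nat n : chi n%:R = omega R p ^+ n.
Proof. by apply: omega_congr; rewrite // natr_Zp. Qed.

Lemma chiD a b : chi (a + b) = chi a * chi b.
Proof. by rewrite -exprD -chi_nat natrD !natr_Zp. Qed.

Lemma chi_eq1 a : (chi a == 1) = (a == 0).
Proof.
have prim := omega_prim R (prime_gt0 pp).
rewrite -(prim_order_dvd prim) /dvdn modn_small //.
by have := ltn_ord a; rewrite [X in (_ < X)%N]Fp_cast.
Qed.

(** Shifting the summation variable by a unit vector on which the character is
    not 1 multiplies the sum by that value. *)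
Lemma sum_chi m (w : 'cV['F_p]_m) :
  \sum_(h : 'cV['F_p]_m) chi ((h^T *m w) 0 0) = if w == 0 then (p ^ m)%:R else 0.
Proof.
case: eqP => [->|/eqP w0].
  under eq_bigr do rewrite mulmx0 mxE.
  by rewrite /chi expr0 sumr_const card_mx card_Fp // muln1.
have [i wi] : exists i, w i 0 != 0 by apply/cV0Pn.
set s := \sum_h _; suff : (chi (w i 0) - 1) * s == 0.
  by rewrite mulf_eq0 subr_eq0 chi_eq1 (negPf wi) => /eqP.
rewrite mulrBl mul1r subr_eq0 {2}/s (reindex_inj (addrI (delta_mx i 0))) /=.
rewrite mulr_sumr; apply/eqP/eq_bigr => h _; rewrite -chiD.
have -> : (delta_mx i 0 + h)^T = delta_mx 0 i + h^T by rewrite linearD /= trmx_delta.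
by rewrite mulmxDl -rowE [in RHS]mxE [row _ _ _ _]mxE.
Qed.

End Character.

(** * Digits and expansions *)

Lemma leq_digit_neq0 p k i : digit p k i != 0%N -> (p ^ i <= k)%N.
Proof.
apply: contraR; rewrite -ltnNge => ki.
by rewrite /digit divn_small // mod0n.
Qed.

Lemma digit_nu1 p k i : prime p -> (nu1 p k <= i)%N -> digit p k i = 0%N.
Proof.
move=> pp; apply: contraTeq; rewrite -ltnNge => ki0.
have ik : (i < k)%N.
  exact: leq_trans (ltn_expl i (prime_gt1 pp)) (leq_digit_neq0 ki0).
exact: (@leq_bigmax_cond _ (fun i : 'I_k => digit p k i != 0%N) _ (Ordinal ik)).
Qed.

(** The digit of k at position [trunc_log p k] is nonzero. *)
Lemma lt_expn_nu1 p k : prime p -> (k < p ^ nu1 p k)%N.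
Proof.
move=> pp; have [->|k0] := posnP k; first by rewrite expn_gt0 prime_gt0.
have /andP[kl ku] := trunc_log_bounds (prime_gt1 pp) k0.
apply: (leq_trans ku); rewrite leq_exp2l ?prime_gt1 // ltnNge.
apply/negP => /(digit_nu1 pp)/eqP; rewrite /digit modn_small.
  by rewrite -leqn0 leqNgt divn_gt0 ?expn_gt0 ?prime_gt0 // kl.
by rewrite ltn_divLR ?expn_gt0 ?prime_gt0 // -expnS.
Qed.

Lemma digit_vec_inj p m n n' : prime p -> (n < p ^ m)%N -> (n' < p ^ m)%N ->
  digit_vec p m n = digit_vec p m n' -> n = n'.
Proof.
move=> pp nm nm' /colP E.
have {}E i : (i < m)%N -> digit p n i = digit p n' i.
  move=> im; have := congr1 val (E (Ordinal im)); rewrite !mxE /=.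
  by rewrite !(val_Fp_nat pp) /digit !modn_mod.
suff H k : (k <= m)%N -> (n %% p ^ k = n' %% p ^ k)%N.
  by have := H m (leqnn m); rewrite !modn_small.
elim: k => [|k IH] km; first by rewrite !modn1.
have split a : (a %% p ^ k.+1 = digit p a k * p ^ k + a %% p ^ k)%N.
  rewrite /digit modn_divl -expnS {1}(divn_eq (a %% p ^ k.+1) (p ^ k)).
  by rewrite [in X in (_ + X)%N]modn_dvdm // dvdn_exp2l.
by rewrite !split E // IH // ltnW.
Qed.

Section Expansion.
Variables (R : realType) (p : nat).
Hypothesis p0 : (0 < p)%N.
Implicit Types (x : R) (d e : nat -> nat).

Let partial_sum d N : R := \sum_(0 <= i < N) (d i)%:R / p%:R ^+ i.+1.

Let pR : 0 < p%:R :> R. Proof. by rewrite ltr0n. Qed.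

(** The sums [partial_sum d N + p ^- N] do not increase, and they decrease
    strictly at every N with [d N != p - 1]; this makes the upper bound strict. *)
Lemma expansion_bounds x d N : is_expansion p x d ->
  partial_sum d N <= x < partial_sum d N + p%:R ^- N.
Proof.
move=> [dp dx dinf].
pose up M := partial_sum d M + p%:R ^- M.
have sS M : partial_sum d M.+1 = partial_sum d M + (d M)%:R / p%:R ^+ M.+1.
  by rewrite /partial_sum big_nat_recr.
have upS M : up M - up M.+1 = (p.-1 - d M)%N%:R / p%:R ^+ M.+1.
  have dM : (d M <= p.-1)%N by rewrite -ltnS prednK.
  rewrite /up sS natrB // -[p.-1]subn1 natrB // exprS; field.
  by rewrite expf_neq0 ?gt_eqF.
have s_mono : {homo partial_sum d : a b / (a <= b)%N >-> a <= b}.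
  apply/nondecreasing_seqP => M; rewrite sS lerDl.
  by rewrite divr_ge0 ?exprn_ge0 ?ler0n.
have up_mono : {homo up : a b / (a <= b)%N >-> b <= a}.
  apply/nonincreasing_seqP => M; rewrite -subr_ge0 upS.
  by rewrite divr_ge0 ?exprn_ge0 ?ler0n.
have limE : limn (partial_sum d) = x by apply/cvg_lim.
have cv : cvgn (partial_sum d) by apply/cvg_ex; exists x.
have le_up M : x <= up M.
  rewrite -limE; apply: limr_le => //; near=> k.
  apply: le_trans (up_mono M k _); last by near: k; apply: nbhs_infty_ge.
  by rewrite lerDl invr_ge0 exprn_ge0 // ltW.
apply/andP; split; first by rewrite -limE; apply: nondecreasing_cvgn_le.
have [i Ni di] := dinf N.
apply: le_lt_trans (le_up i.+1) (lt_le_trans _ (up_mono _ _ Ni)).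
rewrite -subr_gt0 upS divr_gt0 ?exprn_gt0 // ltr0n subn_gt0.
by rewrite ltn_neqAle di -ltnS prednK //=.
Unshelve. all: by end_near.
Qed.

(** If the expansions agree before N and d N < e N, then [expansion_bounds] at N + 1
    gives [partial_sum e N.+1 <= x < partial_sum d N.+1 + p ^- N.+1], hence
    e N < d N + 1, a contradiction. *)
Lemma expansion_unique x d e : is_expansion p x d -> is_expansion p x e -> d = e.
Proof.
have step d' e' N : is_expansion p x d' -> is_expansion p x e' ->
    partial_sum d' N = partial_sum e' N -> (e' N <= d' N)%N.
  move=> xd xe sde; rewrite leqNgt; apply/negP => lt_de.
  have /andP[_] := expansion_bounds N.+1 xd.
  have /andP[+ _] := expansion_bounds N.+1 xe.
  rewrite /partial_sum !big_nat_recr //= -/(partial_sum d' N) -/(partial_sum e' N).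
  rewrite sde => le_x lt_x.
  have := le_lt_trans le_x lt_x; rewrite -addrA ltrD2l.
  rewrite -[X in _ < _ + X]mul1r -mulrDl natr1 ltr_pM2r ?invr_gt0 ?exprn_gt0 //.
  by rewrite ltr_nat ltnS leqNgt lt_de.
move=> xd xe; apply/funext; elim/ltn_ind => N IH.
have sde : partial_sum d N = partial_sum e N.
  by apply: eq_big_nat => i /andP[_ iN]; rewrite IH.
by apply/eqP; rewrite eqn_leq (step _ _ _ xe xd) ?(step _ _ _ xd xe).
Qed.

Lemma expansionE x d : is_expansion p x d -> expansion p x = d.
Proof.
move=> xd; apply: (expansion_unique _ xd).
by apply: (@xgetPex _ _ [set d | is_expansion p x d]); exists d.
Qed.

End Expansion.

Definition pad_digits p m (y : 'cV['F_p]_m) (i : nat) : nat :=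
  oapp (fun i : 'I_m => y i 0%R : nat) 0%N (insub i).

Lemma pad_digits_ord p m (y : 'cV['F_p]_m) (i : 'I_m) : pad_digits y i = y i 0%R.
Proof. by rewrite /pad_digits valK. Qed.

Lemma pad_digits_ge p m (y : 'cV['F_p]_m) i : (m <= i)%N -> pad_digits y i = 0%N.
Proof. by move=> mi; rewrite /pad_digits insubF // ltnNge mi. Qed.

(** The digit 0 differs from p - 1 because p > 1, so the expansion that ends in
    zeros is the admissible one. *)
Lemma expansion_finite (R : realType) p m (y : 'cV['F_p]_m) : prime p ->
  expansion p (\sum_(i < m) (y i 0%R : nat)%:R / p%:R ^+ i.+1 : R) = pad_digits y.
Proof.
move=> pp; have p1 := prime_gt1 pp.
apply: expansionE; first exact: prime_gt0.
split=> [i||N].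
- rewrite /pad_digits; case: insubP => [j _ _|_] /=; last exact: prime_gt0.
  by have := ltn_ord (y j 0); rewrite [X in (_ < X)%N]Fp_cast.
- apply: cvg_near_cst; near=> N.
  have mN : (m <= N)%N by near: N; apply: nbhs_infty_ge.
  rewrite (big_cat_nat _ mN) //= [X in _ + X]big_nat_cond [X in _ + X]big1 ?addr0.
    by rewrite big_mkord; apply: eq_bigr => i _; rewrite pad_digits_ord.
  by move=> i /andP[/andP[mi _] _]; rewrite pad_digits_ge // mul0r.
- exists (maxn N m); first exact: leq_maxl.
  by rewrite pad_digits_ge ?leq_maxr // eq_sym -lt0n; case: p p1 {pp y} => [|[]].
Unshelve. all: by end_near.
Qed.

(** * Walsh functions on the net *)

Lemma sum_nat_vanish (f : nat -> nat) a b :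
  (forall i, (a <= i)%N -> f i = 0%N) -> (forall i, (b <= i)%N -> f i = 0%N) ->
  (\sum_(i < a) f i = \sum_(i < b) f i)%N.
Proof.
wlog ab : a b / (a <= b)%N => [H fa fb|fa _].
  by case: (leqP a b) => [|/ltnW] /H -> //.
rewrite -!(big_mkord xpredT f) [RHS](big_cat_nat _ ab) //= [X in (_ + X)%N]big_nat_cond.
by rewrite [X in (_ + X)%N]big1 ?addn0 // => i /andP[/andP[ai _] _]; apply: fa.
Qed.

Section WalshNet.
Variables (R : realType) (p m s : nat) (C : 'I_s -> 'M['F_p]_m).
Hypothesis pp : prime p.

Lemma wal1_finite (y : 'cV['F_p]_m) k :
  wal1 p k (\sum_(i < m) (y i 0%R : nat)%:R / p%:R ^+ i.+1 : R) =
  chi R (((digit_vec p m k)^T *m y) 0 0).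
Proof.
rewrite /wal1 expansion_finite // -chi_nat //; congr (chi R _).
rewrite (@sum_nat_vanish (fun i => pad_digits y i * digit p k i)%N _ m).
- rewrite natr_sum mxE; apply: eq_bigr => i _.
  by rewrite pad_digits_ord natrM natr_Zp !mxE mulrC.
- by move=> i ki; rewrite (digit_nu1 pp ki) muln0.
- by move=> i mi; rewrite pad_digits_ge.
Qed.

(** The inner product of the digits of the jth component of k with [C j] times
    the digits of n is the inner product of [(C j)^T] times the former with the
    latter, so the Walsh functions of one dual coset agree on the net. *)
Lemma wal_net_point k n :
  wal p k (net_point R C n) = chi R (((dual_map C k)^T *m digit_vec p m n) 0 0).
Proof.
rewrite /wal /dual_map linear_sum mulmx_suml summxE /=.
rewrite (big_morph _ (chiD R pp) (erefl : chi R 0 = 1)).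
apply: eq_bigr => j _; rewrite wal1_finite.
by rewrite trmx_mul trmxK mulmxA.
Qed.

Lemma conj_chi (a : 'F_p) : (chi R a)^* = chi R (- a).
Proof.
have ca : chi R a != 0 by rewrite expf_neq0 // omega_neq0.
apply: (mulfI ca); rewrite -chiD // subrr /chi rmorphXn /= conj_omega.
by rewrite -exprMn divff ?omega_neq0 // expr1n.
Qed.

(** A nonempty dual coset has a smallest value v of nu; the tuples with this
    value have entries below [p ^ v], so one of them is lexicographically least. *)
Lemma dual_map_wavenumber h :
  dual_coset C h !=set0 -> dual_map C (wavenumber C h) = h.
Proof.
move=> [k0 hk0]; suff [k kP] : exists k, (dual_coset C h `&` wavenumbers C) k.
  by have [] := xgetPex [tuple of nseq s 0%N] (ex_intro _ k kP).
have exv : exists v, `[< exists2 k, dual_coset C h k & nu p k = v >].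
  by exists (nu p k0); apply/asboolP; exists k0.
case: (ex_minnP exv) => v /asboolP[k1 hk1 k1v] minv.
pose B := (p ^ v).-1.
pose f (t : s.-tuple 'I_B.+1) : s.-tuplelexi nat := map_tuple val t.
pose g (k : s.-tuple nat) : s.-tuple 'I_B.+1 := map_tuple inord k.
have fg k : nu p k = v -> f (g k) = k.
  move=> kv; apply: eq_from_tnth => j; rewrite !tnth_map /= inordK //.
  rewrite prednK ?expn_gt0 ?prime_gt0 //; apply: leq_trans (lt_expn_nu1 _ pp) _.
  by rewrite leq_exp2l ?prime_gt1 // -kv /nu (bigD1 j) //= leq_addr.
pose P t := `[< dual_coset C h (f t) /\ nu p (f t) = v >].
have P1 : P (g k1) by apply/asboolP; rewrite fg.
case: (arg_minP f P1) => t /asboolP[ht tv] mint.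
exists (f t); split=> // l; rewrite /dual_coset /= ht => hl.
have : (v <= nu p l)%N by apply: minv; apply/asboolP; exists l.
rewrite tv leq_eqVlt => /predU1P[lv|]; [right; split=> //|by left].
rewrite /lex_le -(fg l) //; apply: mint; apply/asboolP.
by rewrite fg.
Qed.

End WalshNet.

(** * Inversion *)

Section Inversion.
Variables (R : realType) (p m s : nat) (C : 'I_s -> 'M['F_p]_m).
Hypothesis pp : prime p.

(** The coefficient of c n' in the transform at n is the average over h of the
    character [h^T *m (v n - v n')], where v n is the digit vector of n. *)
Lemma transform_walsh_coef (c : 'I_(p ^ m) -> R[i]) (n : 'I_(p ^ m)) :
  (forall h, dual_coset C h !=set0) ->
  partial_transform (V := R[i]^o) (omega R p)
    (fun h => walsh_coef C c (wavenumber C h)) m (digit_vec p m n) = c n.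
Proof.
move=> nonempty; rewrite partial_transform_full.
have pm0 : (p ^ m)%:R != 0 :> R[i].
  by rewrite pnatr_eq0 expn_eq0 negb_and -lt0n prime_gt0.
pose v (n : 'I_(p ^ m)) := digit_vec p m n.
transitivity (\sum_n' (p ^ m)%:R^-1 * c n' *
    \sum_(h : 'cV['F_p]_m) chi R ((h^T *m (v n - v n')) 0 0)).
  transitivity (\sum_(h : 'cV['F_p]_m) \sum_n' (p ^ m)%:R^-1 * c n' *
      chi R ((h^T *m (v n - v n')) 0 0)).
    apply: eq_bigr => h _; rewrite /walsh_coef -natrX mulr_sumr scaler_sumr.
    apply: eq_bigr => n' _.
    rewrite wal_net_point // dual_map_wavenumber // conj_chi //.
    have -> : (h^T *m (v n - v n')) 0 0 = (h^T *m v n) 0 0 - (h^T *m v n') 0 0.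
      by rewrite mulmxBr; set y := _ *m _; set y' := _ *m _; rewrite !mxE.
    rewrite chiD // -chi_nat // natr_sum.
    have -> : \sum_(i < m) (h i 0%R * digit_vec p m n i 0%R)%N%:R =
        (h^T *m v n) 0 0.
      by rewrite mxE; apply: eq_bigr => i _; rewrite natrM !natr_Zp !mxE.
    by rewrite -[_ *: _]/(_ * _); ring.
  by rewrite exchange_big; apply: eq_bigr => n' _; rewrite mulr_sumr.
rewrite (bigD1 n) //= [X in _ + X]big1 ?addr0 => [|n' nn'].
  by rewrite subrr sum_chi // eqxx mulrAC mulVf // mul1r.
rewrite sum_chi // ifN ?mulr0 // subr_eq0; apply: contraNneq nn'.
by move=> /digit_vec_inj E; apply/eqP/val_inj; rewrite /= E.
Qed.

Lemma recursionE (c : 'I_(p ^ m) -> R[i]) (D : nat -> 'cV['F_p]_m -> R[i]) r a :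
  is_recursion C c D -> (r <= m)%N ->
  D r a = partial_transform (V := R[i]^o) (omega R p)
    (fun h => walsh_coef C c (wavenumber C h)) r a.
Proof.
move=> [D0 DS]; elim: r a => [|r IH] a rm; first by rewrite partial_transform0 D0.
rewrite (DS (Ordinal rm)) (partial_transformS _ _ (Ordinal rm)) /=.
by apply: eq_bigr => h _; rewrite IH // ltnW.
Qed.

End Inversion.

(** * The recursion as a program *)

Section RecProgram.
Variables (R : realType) (p m : nat) (x : 'cV['F_p]_m -> R[i]).
Hypothesis pp : prime p.
Local Notation reg := (option (nat * 'cV['F_p]_m)).
Local Notation om := (omega R p).
Implicit Types (mem : reg -> R[i]) (a : 'cV['F_p]_m).

Let stage_value mem (r : 'I_m) a (h : 'F_p) : R[i] :=
  om ^+ (h * a r 0%R)%N * value x mem (rec_loc R r (set_coord a r h)).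

Let stage_code (r : 'I_m) a (h : 'F_p) : seq (instr R[i] 'cV['F_p]_m reg) :=
  [:: Mul None (Cst (om ^+ (h * a r 0%R)%N)) (rec_loc R r (set_coord a r h));
      Add (Some (r.+1, a)) (Reg (Some (r.+1, a))) (Reg None)].

(* A stage does not overwrite what it reads. *)
Let stage_value_eq mem mem' (r : 'I_m) :
  (forall r' b, r' != r.+1 -> mem' (Some (r', b)) = mem (Some (r', b))) ->
  stage_value mem' r =2 stage_value mem r.
Proof.
move=> mE a h; rewrite /stage_value; congr (_ * _).
by case: (nat_of_ord r) mE => //= r' -> //; rewrite neq_ltn leqnn.
Qed.

(** Every product overwrites register None, so only the accumulators are tracked. *)
Lemma run_row mem (r : 'I_m) a (hs : seq 'F_p) r' b :
  foldl (step x) mem (flatten [seq stage_code r a h | h <- hs]) (Some (r', b)) =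
  mem (Some (r', b)) +
    if (r', b) == (r.+1, a) then \sum_(h <- hs) stage_value mem r a h else 0.
Proof.
elim: hs mem r' b => [|h hs IH] mem r' b; first by rewrite big_nil if_same addr0.
rewrite /= IH {IH} /store /= !(inj_eq Some_inj).
set mem' := (X in stage_value X).
have -> : \sum_(j <- hs) stage_value mem' r a j = \sum_(j <- hs) stage_value mem r a j.
  apply: eq_bigr => j _; apply: stage_value_eq => r1 b1 r1r.
  by rewrite /mem' (inj_eq Some_inj) xpair_eqE (negPf r1r).
case: eqP => [[-> ->]|_]; last by [].
by rewrite big_cons addrA.
Qed.

Lemma run_stage mem (r : 'I_m) r' b :
  foldl (step x) mem (rec_stage R p r) (Some (r', b)) =
  mem (Some (r', b)) +
    if r' == r.+1 then \sum_h stage_value mem r b h else 0.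
Proof.
suff H (s : seq 'cV['F_p]_m) : uniq s ->
    foldl (step x) mem (flatten [seq flatten [seq stage_code r a h |
      h : 'F_p <- enum 'F_p] | a <- s]) (Some (r', b)) =
    mem (Some (r', b)) +
    if (r' == r.+1) && (b \in s) then \sum_h stage_value mem r b h else 0.
  by rewrite H ?enum_uniq // mem_enum andbT.
elim: s mem => [|a s IH] mem /=; first by rewrite andbF addr0.
move=> /andP[a_s us]; rewrite foldl_cat IH // run_row inE.
set mem' := foldl _ _ _.
have -> : \sum_h stage_value mem' r b h = \sum_h stage_value mem r b h.
  apply: eq_bigr => h _; apply: stage_value_eq => r1 b1 r1r.
  by rewrite /mem' run_row xpair_eqE (negPf r1r) addr0.
rewrite xpair_eqE; case: eqP => [_|_] /=; last by rewrite !addr0.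
have [ba|ba] := eqVneq b a; last by rewrite addr0.
by rewrite ba (negPf a_s) addr0 -big_enum.
Qed.

(** After k stages the registers of index at most k hold the partial transforms,
    and the others still hold 0. *)
Lemma run_rec_program r a : (r <= m)%N ->
  result (rec_program R p m) x (rec_loc R r a) =
  partial_transform (V := R[i]^o) om x r a.
Proof.
case: r => [|r] rm; first by rewrite partial_transform0.
rewrite /result /= /rec_program -[enum 'I_m]take_size size_enum_ord.
suff H k r' b : (k <= m)%N ->
    run (flatten [seq rec_stage R p r | r <- take k (enum 'I_m)]) x (Some (r'.+1, b)) =
    if (r' < k)%N then partial_transform (V := R[i]^o) om x r'.+1 b else 0.
  by rewrite H // rm.
elim: k r' b => [|k IH] r' b km; first by rewrite take0.
have ksz : (k < size (enum 'I_m))%N by rewrite size_enum_ord.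
rewrite (take_nth (Ordinal km) ksz) map_rcons flatten_rcons /run foldl_cat.
rewrite run_stage -/(run _ x) IH ?(ltnW km) //.
have -> : nth (Ordinal km) (enum 'I_m) k = Ordinal km.
  by apply: val_inj; rewrite /= nth_enum_ord.
rewrite eqSS /= [(r' < k.+1)%N]ltnS [(r' <= k)%N]leq_eqVlt orbC.
case: ltngtP => [_|_|r'k] /=; rewrite ?addr0 // add0r r'k.
rewrite (partial_transformS _ _ (Ordinal km)); apply: eq_bigr => h _.
rewrite /stage_value /=; congr (_ * _); case: k {r'k ksz} IH km => [|k] IH km /=.
  by rewrite partial_transform0.
by rewrite -/(run _ x) IH ?(ltnW km) // ltnSn.
Qed.

Lemma size_rec_program : size (rec_program R p m) = (m * (p ^ m * (p * 2)))%N.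
Proof.
have size_blocks T U (s : seq T) (f : T -> seq U) n :
    (forall t, size (f t) = n) -> size (flatten [seq f t | t <- s]) = (size s * n)%N.
  by move=> fn; elim: s => //= t s IH; rewrite size_cat fn IH mulSn.
rewrite (size_blocks _ _ _ _ (p ^ m * (p * 2))%N) ?size_enum_ord // => r.
rewrite (size_blocks _ _ _ _ (p * 2)%N).
  by rewrite -cardE card_mx card_Fp // muln1.
by move=> a; rewrite (size_blocks _ _ _ _ 2%N) // -cardE card_Fp.
Qed.

End RecProgram.

(** As 2 ^ (k - 1) < 2 * p for the exponent k, k * ln 2 <= 2 * ln 2 + ln p. *)
Lemma up_log_le_ln (R : realType) p : (1 < p)%N ->
  (up_log 2 (2 * p))%:R * ln 2 <= 3 * ln p%:R :> R.
Proof.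
move=> p1; set k := up_log 2 _.
have ln2 : ln 2 <= ln p%:R :> R by rewrite ler_ln ?posrE ?ltr0n ?ler_nat // ltnW.
have k0 : (0 < k)%N by rewrite up_log_gt0; lia.
have : ln (2 ^+ k.-1) <= ln (2 * p%:R) :> R.
  have : (2 ^ k.-1 < 2 * p)%N by apply: up_log_gtn; lia.
  rewrite ler_ln ?posrE ?exprn_gt0 ?mulr_gt0 ?ltr0n //; last exact: ltnW.
  by rewrite -natrX -natrM ler_nat; apply: ltnW.
rewrite lnXn ?ltr0n // lnM ?posrE ?ltr0n //; last exact: ltnW.
by rewrite -[ln 2 *+ _]mulr_natl -{2}(prednK k0) -natr1; lra.
Qed.

(** * Reconstruction and its cost *)

Theorem mainTheorem3 (R : realType) : exists A B : R,
  forall (p m s : nat), prime p -> (0 < m)%N -> (0 < s)%N ->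
  forall C : 'I_s -> 'M['F_p]_m, (forall h, dual_coset C h !=set0) ->
  [/\ forall (c : 'I_(p ^ m) -> R[i]) (D : nat -> 'cV['F_p]_m -> R[i]),
        is_recursion C c D ->
        forall n : 'I_(p ^ m), c n = D m (digit_vec p m n),
      (size (rec_program R p m))%:R <= A * (m * p ^ m.+1)%N%:R /\
      forall (c : 'I_(p ^ m) -> R[i]) (D : nat -> 'cV['F_p]_m -> R[i]),
        is_recursion C c D ->
        let x h := walsh_coef C c (wavenumber C h) in
        (forall (r : nat) (a : 'cV['F_p]_m), (r <= m)%N ->
           result (rec_program R p m) x (rec_loc R r a) = D r a) /\
        (forall n : 'I_(p ^ m),
           result (rec_program R p m) x (rec_loc R m (digit_vec p m n)) = c n)
    & exists (P : seq (instr R[i] 'cV['F_p]_m nat))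
             (out : 'I_(p ^ m) -> operand R[i] 'cV['F_p]_m nat),
        (size P)%:R <= B * (m * p ^ m)%N%:R * ln p%:R /\
        forall (c : 'I_(p ^ m) -> R[i]) (n : 'I_(p ^ m)),
          result P (fun h => walsh_coef C c (wavenumber C h)) (out n) = c n].
Proof.
(* The fast program has at most 24 * k * m * p ^ m operations, where k is the
   exponent of the padded length and k * ln 2 <= 3 * ln p. *)
exists 2, (72 / ln 2) => p m s pp m0 s0 C nonempty; split.
- move=> c D rec n.
  by rewrite (recursionE _ rec) // transform_walsh_coef.
- split; first by rewrite size_rec_program // -natrM ler_nat expnS; lia.
  move=> c D rec x; split=> [r a rm|n]; rewrite run_rec_program //.
    by rewrite (recursionE _ rec).
  exact: transform_walsh_coef.
- pose F := R[i]; pose forms := ('cV['F_p]_m -> F) -> F^o.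
  pose inp (i : 'cV['F_p]_m) : forms := fun x => x i.
  set k := up_log 2 (2 * p).
  have prim : (2 ^ k)%N.-primitive_root (omega R (2 ^ k)).
    by apply: omega_prim; rewrite expn_gt0.
  have [P sP outP] := derives_program
    (derives_transform inp pp (omega_neq0 R p) prim).
  have out n := cid (outP _ (ex_intro2 _ _ (digit_vec p m n) I erefl)).
  exists P, (fun n => sval (out n)); split.
    have ln2 : 0 < ln 2 :> R by rewrite ln_gt0 // ltr1n.
    have : (size P)%:R <= (m * (24 * k * p ^ m))%N%:R :> R by rewrite ler_nat.
    move=> /le_trans; apply.
    have -> : 72 / ln 2 * (m * p ^ m)%N%:R * ln p%:R =
        (24 * (m * p ^ m)%N%:R / ln 2) * (3 * ln p%:R) :> R by field; rewrite gt_eqF.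
    have -> : (m * (24 * k * p ^ m))%N%:R =
        (24 * (m * p ^ m)%N%:R / ln 2) * (k%:R * ln 2) :> R.
      by rewrite !natrM; field; rewrite gt_eqF.
    apply: ler_wpM2l; last exact: up_log_le_ln (prime_gt1 pp).
    by rewrite divr_ge0 ?mulr_ge0 ?ler0n // ltW.
  move=> c n; rewrite (svalP (out n)) -[RHS](transform_walsh_coef pp c n nonempty).
  by rewrite !partial_transform_full fct_sumE.
Qed.
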